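(* Let $\nu$ be a Borel probability measure on $\mathbb{R}$. If for some integer $n\ge 1$ the convolution power $\nu^{\ast n}=\nu\ast\nu\ast\dots\ast\nu$ ($n$ factors) is universal for ergodic flows, then the measure $\nu$ is also universal for ergodic flows.
   Context: A flow $(T_t)_{t\in\mathbb{R}}$ is a (jointly measurable) measure-preserving action of $\mathbb{R}$ on a standard probability space $(X,\mu)$; it is ergodic if every invariant measurable set has measure $0$ or $1$. A Borel probability measure $\nu$ on $\mathbb{R}$ is called universal (for ergodic flows) if for every ergodic flow $T_t$ on a standard probability space $(X,\mu)$ and every $f\in L_1(X,\mu)$, $$\left\|\int_{\mathbb{R}} f(T_{rt}x)\, d\nu(r) -\int_X f \, d\mu\right\|_{L_1(\mu)}\to 0 \quad\text{as } t\to +\infty .$$ *)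

(* Defs.v *)
From HB Require Import structures.
From mathcomp Require Import all_boot all_order all_algebra.
From mathcomp Require Import all_classical all_reals all_analysis.
From mathcomp Require Import measurable_realfun.

Set Implicit Arguments.
Unset Strict Implicit.
Unset Printing Implicit Defensive.
Import Order.TTheory GRing.Theory Num.Theory.
Import numFieldNormedType.Exports.

Local Open Scope classical_set_scope.
Local Open Scope ring_scope.

Definition complete_metric (R : realType) (Y : metricType R) : Prop :=
  forall F : set_system Y, ProperFilter F -> cauchy F -> exists y : Y, F --> y.

Definition separable_space (Y : topologicalType) : Prop :=
  exists2 D : set Y, countable D & dense D.

(* [X] is isomorphic, as a measurable space, to a Polish space [Y] with its
   Borel sigma-algebra. *)
Definition standard_borel (R : realType) (d : measure_display)
    (X : measurableType d) : Prop :=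
  exists (Y : metricType R) (phi : X -> Y),
    [/\ complete_metric Y, separable_space Y, bijective phi &
        forall A : set X, measurable A <->
          exists2 B : set Y, <<s (@open Y) >> B & A = phi @^-1` B].

Record is_flow (R : realType) (d : measure_display) (X : measurableType d)
    (mu : probability X R) (T : R -> X -> X) : Prop := IsFlow {
  flow_measurable :
    measurable_fun setT (fun p : measurableTypeR R * X => T p.1 p.2) ;
  flow0 : forall x, T 0 x = x ;
  flowD : forall s t x, T (s + t) x = T s (T t x) ;
  flow_preserving :
    forall t (A : set X), measurable A -> mu (T t @^-1` A) = mu A
}.

Definition ergodic (R : realType) (d : measure_display) (X : measurableType d)
    (mu : probability X R) (T : R -> X -> X) : Prop :=
  forall A : set X, measurable A -> (forall t, T t @^-1` A = A) ->
    mu A = 0%E \/ mu A = 1%E.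

(* By Fubini, [r |-> f (T (r * t) x)] is [nu]-integrable for [mu]-almost every
   [x]; the extended-real value taken on the exceptional null set does not
   affect the L1 norm. *)
Definition average_error (R : realType) (d : measure_display)
    (X : measurableType d) (mu : probability X R)
    (nu : probability (measurableTypeR R) R) (T : R -> X -> X) (f : X -> R)
    (t : R) (x : X) : \bar R :=
  (\int[nu]_r (f (T (r * t)%R x))%:E - \int[mu]_y (f y)%:E)%E.

Definition universal (R : realType) (nu : probability (measurableTypeR R) R)
    : Prop :=
  forall (d : measure_display) (X : measurableType d) (mu : probability X R)
    (T : R -> X -> X) (f : X -> R),
  standard_borel R X -> is_flow mu T -> ergodic mu T ->
  mu.-integrable setT (EFin \o f) ->
  ('N[mu]_1 [average_error mu nu T f t])%E @[t --> +oo] --> 0%E.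

Section convolution.
Variable R : realType.

Definition real_add (p : measurableTypeR R * measurableTypeR R)
  : measurableTypeR R := p.1 + p.2.

Let measurable_real_add : measurable_fun setT real_add.
Proof.
by apply: measurable_funD; [exact: measurable_fst | exact: measurable_snd].
Qed.

HB.instance Definition _ := isMeasurableFun.Build _ _ _ _ real_add measurable_real_add.

Definition convolution (nu1 nu2 : probability (measurableTypeR R) R)
  : probability (measurableTypeR R) R := distribution (nu1 \x nu2)%E real_add.

(* [convolution_power nu n] has [n] factors; the empty power is the unit of
   convolution. *)
Fixpoint convolution_power (nu : probability (measurableTypeR R) R) (n : nat)
  : probability (measurableTypeR R) R :=
  if n is m.+1 then convolution nu (convolution_power nu m)
  else @dirac _ (measurableTypeR R) 0 R.

End convolution.

(* Main.v *)
Require Import Defs.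
From mathcomp Require Import all_boot all_order all_algebra.
From mathcomp Require Import all_classical all_reals all_analysis.
From mathcomp Require Import measurable_realfun ring lra.

(** Let A f (x) be the integral of f (T_{rt} x) with respect to nu(dr). By
    Fubini, averaging along the convolution of nu and rho is averaging along
    rho and then along nu ([average_convolution]), so the average along the
    n-th convolution power of nu is the n-th power of A. The adjoint of A on L2
    is the average along the time-reversed flow ([average_adjoint]), and it
    commutes with A because the flow is commutative: A is a normal operator.

    For normal operators, decay of a power forces decay of the operator.
    Indeed, |A* h| = |A h| in L2 norm, so that
      |A g|^2 = <g, A* A g> <= |g| |A* A g| = |g| |A A g|.
    On functions bounded by M, L1 and L2 norms control each other, and the
    inequality takes the form
      (L1 norm of A g)^4 <= M^3 (L1 norm of A A g)
    ([Rintegral_norm_average_le]). Applied with g the average of a centred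
    bounded function along the n-th power of nu, it transfers convergence to 0
    from exponent n+2 to exponent n+1 ([universal_bounded_convolution]), and
    one descends to exponent 1.

    The argument needs bounded functions, but averages are contractions of L1
    and bounded functions are dense there, so universality can be tested on
    bounded functions of mean zero ([universalP]). *)

Set Implicit Arguments.
Unset Strict Implicit.
Unset Printing Implicit Defensive.
Import Order.TTheory GRing.Theory Num.Theory.
Import numFieldNormedType.Exports.

Local Open Scope classical_set_scope.
Local Open Scope ring_scope.

(** * Bounded measurable functions *)

Definition bounded_measurable (R : realType) (d : measure_display)
    (X : measurableType d) (M : R) (f : X -> R) : Prop :=
  measurable_fun setT f /\ forall x, `|f x| <= M.

Section BoundedMeasurable.
Context (R : realType) (d : measure_display) (X : measurableType d).
Implicit Types (M N : R) (f g : X -> R).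

Lemma bounded_measurableM M N f g :
  bounded_measurable M f -> bounded_measurable N g ->
  bounded_measurable (M * N) (f \* g).
Proof.
move=> [mf fM] [mg gN]; split; first exact: measurable_funM.
by move=> x; rewrite normrM ler_pM.
Qed.

Lemma bounded_measurable_sqr M f :
  bounded_measurable M f -> bounded_measurable (M ^+ 2) (fun x => f x ^+ 2).
Proof. by move=> bf; exact: (bounded_measurableM bf bf). Qed.

Lemma bounded_measurable_cst (c : R) : bounded_measurable `|c| (fun _ : X => c).
Proof. by split => //; exact: measurable_cst. Qed.

Lemma bounded_measurableZl c M f :
  bounded_measurable M f -> bounded_measurable (`|c| * M) (fun x => c * f x).
Proof. exact: (bounded_measurableM (bounded_measurable_cst c)). Qed.

Lemma bounded_measurable_norm M f :
  bounded_measurable M f -> bounded_measurable M (fun x => `|f x|).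
Proof.
by move=> [mf fM]; split; [exact: measurableT_comp | move=> x; rewrite normr_id].
Qed.

Lemma bounded_measurable_comp d' (Y : measurableType d') (h : Y -> X) M f :
  measurable_fun setT h -> bounded_measurable M f ->
  bounded_measurable M (f \o h).
Proof.
by move=> mh [mf fM]; split; [exact: measurableT_comp | move=> x; exact: fM].
Qed.

Variable P : probability X R.

Lemma bounded_measurable_integrable M f :
  bounded_measurable M f -> P.-integrable setT (EFin \o f).
Proof.
move=> [mf fM]; apply: measurable_bounded_integrable => //.
  by rewrite (le_lt_trans (probability_le1 _ _))// ltry.
exists M; split; first exact: num_real.
by move=> y My x _; exact: le_trans (fM x) (ltW My).
Qed.

Lemma Rintegral_cst_probability (r : R) : \int[P]_x r = r.
Proof. by rewrite Rintegral_cst// [X in fine X]probability_setT mulr1. Qed.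

Lemma norm_Rintegral_le M f :
  bounded_measurable M f -> `|\int[P]_x f x| <= M.
Proof.
move=> bf; have fi := bounded_measurable_integrable bf.
rewrite (le_trans (le_normr_Rintegral _ fi))//.
rewrite -[leRHS](Rintegral_cst_probability M); apply: le_Rintegral => //.
- exact: (bounded_measurable_integrable (bounded_measurable_norm bf)).
- exact: (bounded_measurable_integrable (bounded_measurable_cst _)).
- by move=> x _; case: bf.
Qed.

(** Jensen's inequality for the square: the variance of |f| is nonnegative. *)
Lemma sqr_Rintegral_norm_le M f : bounded_measurable M f ->
  (\int[P]_x `|f x|) ^+ 2 <= \int[P]_x (f x) ^+ 2.
Proof.
move=> bf; set c := \int[P]_x `|f x|.
have bn := bounded_measurable_norm bf.
have inorm := bounded_measurable_integrable bn.
have isqr : P.-integrable setT (EFin \o (fun x => f x ^+ 2)).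
  exact: (bounded_measurable_integrable (bounded_measurable_sqr bf)).
(* with c the mean of |f|, integrate 2 c |f| - c^2 <= |f|^2 *)
have icst : P.-integrable setT (EFin \o (fun=> c ^+ 2)).
  exact: (bounded_measurable_integrable (bounded_measurable_cst _)).
have iabs : P.-integrable setT (EFin \o (fun x => 2 * c * `|f x|)).
  exact: (bounded_measurable_integrable
    (bounded_measurableZl (2 * c) bn)).
have ilin : P.-integrable setT (EFin \o (fun x => 2 * c * `|f x| - c ^+ 2)).
  by apply: (integrableB _ iabs icst).
have -> : c ^+ 2 = \int[P]_x (2 * c * `|f x| - c ^+ 2).
  rewrite RintegralB// RintegralZl// Rintegral_cst_probability -/c; ring.
apply: le_Rintegral => // x _.
rewrite -[X in _ <= X]real_normK ?num_real//.
have : 0 <= (`|f x| - c) ^+ 2 by exact: sqr_ge0.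
nra.
Qed.

End BoundedMeasurable.

(** * Fubini for bounded functions on a product of probability spaces *)

Section BoundedFubini.
Context (R : realType) (d1 d2 : measure_display) (X : measurableType d1)
  (Y : measurableType d2) (P : probability X R) (Q : probability Y R).
Variables (M : R) (f : X * Y -> R).
Hypothesis bf : bounded_measurable M f.

Let intf : (P \x Q)%E.-integrable setT (EFin \o f).
Proof. exact: (bounded_measurable_integrable _ bf). Qed.

Let bf1 x : bounded_measurable M (fun y => f (x, y)).
Proof. by apply: (bounded_measurable_comp _ bf); exact: measurable_fun_pair. Qed.

Let bf2 y : bounded_measurable M (fun x => f (x, y)).
Proof. by apply: (bounded_measurable_comp _ bf); exact: measurable_fun_pair. Qed.

Lemma bounded_measurable_Rintegral :
  bounded_measurable M (fun y => \int[P]_x f (x, y)).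
Proof.
split; last by move=> x; exact: norm_Rintegral_le.
apply: measurableT_comp => //.
exact: (measurable_fubini_G intf).
Qed.

Let E1 x : (\int[Q]_y (f (x, y))%:E = (\int[Q]_y f (x, y))%:E)%E.
Proof.
rewrite fineK//; apply: integrable_fin_num => //.
exact: (bounded_measurable_integrable _ (bf1 x)).
Qed.

Let E2 y : (\int[P]_x (f (x, y))%:E = (\int[P]_x f (x, y))%:E)%E.
Proof.
rewrite fineK//; apply: integrable_fin_num => //.
exact: (bounded_measurable_integrable _ (bf2 y)).
Qed.

Lemma Rintegral_prod :
  \int[(P \x Q)%E]_z f z = \int[P]_x \int[Q]_y f (x, y).
Proof.
rewrite /Rintegral -(integral12_prod_meas1 intf) /fubini_F.
by congr fine; apply: eq_integral => x _; rewrite /= E1.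
Qed.

Lemma Rintegral_Fubini :
  \int[P]_x \int[Q]_y f (x, y) = \int[Q]_y \int[P]_x f (x, y).
Proof.
rewrite /Rintegral.
under eq_integral do rewrite -/(Rintegral _ _ _) -E1.
under [in RHS]eq_integral do rewrite -/(Rintegral _ _ _) -E2.
by rewrite (Fubini intf).
Qed.

End BoundedFubini.

(** * Flows and averages along them *)

(** Absorbs the dilation by t into the flow, so that the averages can be studied
    along a single flow; [rescale T (-1)] is the time reversal of T. *)
Definition rescale (R : realType) (X : Type) (T : R -> X -> X) (t : R)
  : R -> X -> X := fun r => T (r * t).

Definition average (R : realType) (X : Type)
    (nu : probability (measurableTypeR R) R) (T : R -> X -> X) (f : X -> R)
    (x : X) : R := \int[nu]_r f (T r x).

Section Flow.
Context (R : realType) (d : measure_display) (X : measurableType d).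
Variables (mu : probability X R) (T : R -> X -> X).
Hypothesis flowT : is_flow mu T.

Lemma flow_rescale t : is_flow mu (rescale T t).
Proof.
case: flowT => mT T0 TD Tmu; split.
- have mscale : measurable_fun setT
      (fun p : measurableTypeR R * X => (p.1 * t : measurableTypeR R, p.2)).
    apply: measurable_fun_pair => //.
    by apply: measurable_funM => //; exact: measurable_fst.
  exact: (measurableT_comp mT mscale).
- by move=> x; rewrite /rescale mul0r.
- by move=> r s x; rewrite /rescale mulrDl.
- by move=> s A mA; exact: Tmu.
Qed.

Lemma flow_comm r s x : T r (T s x) = T s (T r x).
Proof. by rewrite -!(flowD flowT) addrC. Qed.

Lemma flowK r x : T r (T (- r) x) = x.
Proof. by rewrite -(flowD flowT) subrr (flow0 flowT). Qed.

Lemma measurable_flow r : measurable_fun setT (T r).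
Proof.
have mr : measurable_fun setT (fun x : X => (r : measurableTypeR R, x)).
  exact: measurable_fun_pair.
exact: (measurableT_comp (flow_measurable flowT) mr).
Qed.

Lemma ge0_integral_flow r (f : X -> \bar R) :
  measurable_fun setT f -> (forall x, 0 <= f x)%E ->
  (\int[mu]_x f (T r x) = \int[mu]_x f x)%E.
Proof.
move=> mf f0.
have := ge0_integral_pushforward (measurable_flow r) mu measurableT mf
  (fun x _ => f0 x).
rewrite preimage_setT => <-.
apply: eq_measure_integral => [|mTr A mA _]; first exact: measurable_flow.
exact: (flow_preserving flowT).
Qed.

Lemma Rintegral_flow M r (f : X -> R) : bounded_measurable M f ->
  \int[mu]_x f (T r x) = \int[mu]_x f x.
Proof.
move=> bf; congr fine.
have bfT := bounded_measurable_comp (measurable_flow r) bf.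
have ifT := bounded_measurable_integrable mu bfT.
have mf : measurable_fun setT (EFin \o f).
  by apply: measurableT_comp => //; case: bf.
have := @integral_pushforward _ _ _ _ _ _ (measurable_flow r) mu setT _ mf.
rewrite preimage_setT => /(_ ifT measurableT) <-.
apply: eq_measure_integral => [|mTr A mA _]; first exact: measurable_flow.
by rewrite -[RHS](flow_preserving flowT r).
Qed.

Implicit Type nu : probability (measurableTypeR R) R.

Lemma bounded_measurable_orbit M (f : X -> R) : bounded_measurable M f ->
  bounded_measurable M (fun p : measurableTypeR R * X => f (T p.1 p.2)).
Proof. exact: (bounded_measurable_comp (flow_measurable flowT)). Qed.

Lemma bounded_measurable_time M (f : X -> R) x : bounded_measurable M f ->
  bounded_measurable M (fun r : measurableTypeR R => f (T r x)).
Proof.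
move=> bf; have mx : measurable_fun setT (fun r : measurableTypeR R => (r, x)).
  exact: measurable_fun_pair.
exact: (bounded_measurable_comp mx (bounded_measurable_orbit bf)).
Qed.

Lemma bounded_measurable_average nu M (f : X -> R) :
  bounded_measurable M f -> bounded_measurable M (average nu T f).
Proof.
move=> /bounded_measurable_orbit bf.
exact: (bounded_measurable_Rintegral nu mu bf).
Qed.

End Flow.

(** * The average as a normal operator *)

Section Average.
Context (R : realType) (d : measure_display) (X : measurableType d).
Variables (mu : probability X R) (T : R -> X -> X).
Hypothesis flowT : is_flow mu T.
Variable nu : probability (measurableTypeR R) R.

Let flowV := flow_rescale flowT (-1).

(** By invariance of mu under T_r, the integrals of f (T_r x) g (x) and of
    f (x) g (T_{-r} x) agree for each r; then integrate over r. *)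
Lemma average_adjoint M N (f g : X -> R) :
  bounded_measurable M f -> bounded_measurable N g ->
  \int[mu]_x (average nu T f x * g x) =
  \int[mu]_x (f x * average nu (rescale T (-1)) g x).
Proof.
move=> bf bg.
have bfg : bounded_measurable (M * N)
    (fun p : measurableTypeR R * X => f (T p.1 p.2) * g p.2).
  exact: (bounded_measurableM (bounded_measurable_orbit flowT bf)
    (bounded_measurable_comp measurable_snd bg)).
have bfg' : bounded_measurable (M * N)
    (fun p : measurableTypeR R * X => f p.2 * g (rescale T (-1) p.1 p.2)).
  exact: (bounded_measurableM (bounded_measurable_comp measurable_snd bf)
    (bounded_measurable_orbit flowV bg)).
transitivity (\int[mu]_x \int[nu]_r (f (T r x) * g x)).
  apply: eq_Rintegral => x _; rewrite RintegralZr//.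
  exact: (bounded_measurable_integrable _ (bounded_measurable_time flowT x bf)).
transitivity (\int[mu]_x \int[nu]_r (f x * g (rescale T (-1) r x))); last first.
  apply: eq_Rintegral => x _; rewrite RintegralZl//.
  exact: (bounded_measurable_integrable _ (bounded_measurable_time flowV x bg)).
rewrite -(Rintegral_Fubini nu mu bfg) -(Rintegral_Fubini nu mu bfg').
apply: eq_Rintegral => r _.
have bh : bounded_measurable (M * N) (fun x => f (T r x) * g x).
  have bfr := bounded_measurable_comp (measurable_flow flowT r) bf.
  exact: (bounded_measurableM bfr bg).
rewrite -(Rintegral_flow flowV r bh); apply: eq_Rintegral => x _.
by rewrite /rescale mulrN1 (flowK flowT).
Qed.

(** Normality: both sides are double integrals of f (T_r T_{-s} x). *)
Lemma average_reverse_comm M (f : X -> R) : bounded_measurable M f ->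
  average nu T (average nu (rescale T (-1)) f) =
  average nu (rescale T (-1)) (average nu T f).
Proof.
move=> bf; apply/funext => x; rewrite /average.
have b2 : bounded_measurable M (fun p : measurableTypeR R * measurableTypeR R =>
    f (rescale T (-1) p.2 (T p.1 x))).
  have /= b3 := bounded_measurable_orbit flowV bf.
  have m1 : measurable_fun setT
      (fun p : measurableTypeR R * measurableTypeR R => (p.1, x)).
    by apply: measurable_fun_pair => //; exact: measurable_fst.
  have m2 := measurable_fun_pair (@measurable_snd _ _ _ _)
    (measurableT_comp (flow_measurable flowT) m1).
  exact: (bounded_measurable_comp m2 b3).
rewrite (Rintegral_Fubini nu nu b2).
apply: eq_Rintegral => r _; apply: eq_Rintegral => s _.
by rewrite /rescale (flow_comm flowT).
Qed.

(** |A* f| = |A f| for a normal operator: <A* f, A* f> = <f, A A* f>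
    = <f, A* A f> = <A f, A f>. *)
Lemma Rintegral_sqr_average_reverse M (f : X -> R) : bounded_measurable M f ->
  \int[mu]_x (average nu (rescale T (-1)) f x) ^+ 2 =
  \int[mu]_x (average nu T f x) ^+ 2.
Proof.
move=> bf.
have bA := bounded_measurable_average flowT nu bf.
have bV := bounded_measurable_average flowV nu bf.
under eq_Rintegral do rewrite expr2.
under [in RHS]eq_Rintegral do rewrite expr2.
rewrite (average_adjoint bf bA) -(average_adjoint bV bf).
apply: eq_Rintegral => x _.
by rewrite mulrC (average_reverse_comm bf).
Qed.

(** Writing |.|_p for Lp norms, the chain is
      |A g|_1^4 <= |A g|_2^4 = <g, A* A g>^2 <= M^2 |A* A g|_1^2
                <= M^2 |A* A g|_2^2 = M^2 |A A g|_2^2 <= M^3 |A A g|_1. *)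
Lemma Rintegral_norm_average_le M (g : X -> R) : bounded_measurable M g ->
  (\int[mu]_x `|average nu T g x|) ^+ 4 <=
  M ^+ 3 * \int[mu]_x `|average nu T (average nu T g) x|.
Proof.
move=> bg.
have M0 : 0 <= M by case: bg => _ /(_ point); apply: le_trans.
have bA := bounded_measurable_average flowT nu bg.
have bAA := bounded_measurable_average flowT nu bA.
have bVA := bounded_measurable_average flowV nu bA.
have sqr1 : \int[mu]_x (average nu T g x) ^+ 2 <=
    M * \int[mu]_x `|average nu (rescale T (-1)) (average nu T g) x|.
  under eq_Rintegral do rewrite expr2.
  rewrite (average_adjoint bg bA) -RintegralZl//; last first.
    exact: (bounded_measurable_integrable _ (bounded_measurable_norm bVA)).
  apply: le_Rintegral => //.
  - exact: (bounded_measurable_integrable _ (bounded_measurableM bg bVA)).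
  - exact: (bounded_measurable_integrable _ (bounded_measurableZl M
      (bounded_measurable_norm bVA))).
  - move=> x _; rewrite (le_trans (ler_norm _))// normrM ler_wpM2r//.
    by case: bg.
have sqr2 : \int[mu]_x (average nu T (average nu T g) x) ^+ 2 <=
    M * \int[mu]_x `|average nu T (average nu T g) x|.
  rewrite -RintegralZl//; last first.
    exact: (bounded_measurable_integrable _ (bounded_measurable_norm bAA)).
  apply: le_Rintegral => //.
  - exact: (bounded_measurable_integrable _ (bounded_measurable_sqr bAA)).
  - exact: (bounded_measurable_integrable _ (bounded_measurableZl M
      (bounded_measurable_norm bAA))).
  - move=> x _; rewrite -real_normK ?num_real// expr2 ler_wpM2r//.
    by case: bAA.
have jensen1 := sqr_Rintegral_norm_le mu bA.
have jensen2 := sqr_Rintegral_norm_le mu bVA.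
rewrite (Rintegral_sqr_average_reverse bA) in jensen2.
have sqr3 := le_trans jensen2 sqr2.
have sqr4 := le_trans jensen1 sqr1.
have J0 : 0 <= \int[mu]_x `|average nu (rescale T (-1)) (average nu T g) x|.
  by apply: Rintegral_ge0 => x _; exact: normr_ge0.
(* I, J, K are the L1 norms of A g, A* A g and A A g *)
move: (\int[mu]_x _) (\int[mu]_x _) (\int[mu]_x _) sqr3 sqr4 J0.
move=> I K J J2 I2 J0.
have MJ2 : (I ^+ 2) ^+ 2 <= (M * J) ^+ 2.
  by rewrite !expr2 ler_pM ?sqr_ge0 ?mulr_ge0.
have M2 : M ^+ 2 * J ^+ 2 <= M ^+ 2 * (M * K) by rewrite ler_wpM2l ?sqr_ge0.
rewrite -[4%N]/(2 * 2)%N exprM (le_trans MJ2)// exprMn (le_trans M2)//.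
by rewrite mulrA -exprSr.
Qed.

Lemma average_convolution (nu1 nu2 : probability (measurableTypeR R) R) M
    (f : X -> R) : bounded_measurable M f ->
  average (convolution nu1 nu2) T f = average nu1 T (average nu2 T f).
Proof.
move=> bf; apply/funext => x; rewrite /average.
have bt := bounded_measurable_time flowT x bf.
have madd : measurable_fun setT (@real_add R) by exact: measurable_funPT.
have b2 := bounded_measurable_comp madd bt.
transitivity (\int[(nu1 \x nu2)%E]_p (f (T (real_add p) x))).
  congr fine; apply: integral_distribution.
    by apply: measurableT_comp => //; case: bt.
  exact: (bounded_measurable_integrable _ b2).
rewrite (Rintegral_prod nu1 nu2 b2).
apply: eq_Rintegral => r _; apply: eq_Rintegral => s _.
by rewrite /real_add /= addrC (flowD flowT).
Qed.

Lemma average_dirac0 M (f : X -> R) : bounded_measurable M f ->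
  average (@dirac _ (measurableTypeR R) 0 R) T f = f.
Proof.
move=> bf; apply/funext => x; rewrite /average /Rintegral integral_dirac//; last first.
  by apply: measurableT_comp => //; case: (bounded_measurable_time flowT x bf).
by rewrite [X in (X * _)%E]diracT mul1e /= (flow0 flowT).
Qed.

End Average.

(** * Convergence to 0 *)

Lemma ge0_cvge0 (R : realType) (S : Type) (F : set_system S) (u : S -> \bar R)
    {FF : Filter F} : (forall t, 0 <= u t)%E ->
  (forall e : R, 0 < e -> \forall t \near F, (u t <= e%:E)%E) ->
  u @ F --> 0%E.
Proof.
move=> u0 ue; apply/fine_cvgP; split.
  near=> t; rewrite ge0_fin_numE//.
  apply: (@le_lt_trans _ _ 1%:E); last exact: ltry.
  by near: t; exact: ue.
apply/cvgrPdist_le => e e0; near=> t.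
have ut : (u t <= e%:E)%E by near: t; exact: ue.
have fut : u t \is a fin_num by rewrite ge0_fin_numE// (le_lt_trans ut)// ltry.
by rewrite sub0r normrN /= ger0_norm ?fine_ge0// -lee_fin fineK.
Unshelve. all: by end_near. Qed.

Lemma cvg0_expn_le (R : realType) (S : Type) (F : set_system S) (n : nat)
    (C : R) (u v : S -> R) {FF : Filter F} : (0 < n)%N -> 0 <= C ->
  (forall t, 0 <= u t) -> (forall t, u t ^+ n <= C * v t) ->
  v @ F --> 0 -> u @ F --> 0.
Proof.
move=> n0 C0 u0 uv v0; apply/cvgrPdist_le => e e0.
have d0 : 0 < e ^+ n / (C + 1) by rewrite divr_gt0 ?exprn_gt0 ?ltr_wpDl.
move/cvgrPdist_le : v0 => /(_ _ d0); apply: filterS => t.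
rewrite !sub0r !normrN (ger0_norm (u0 t)) => /(le_trans (ler_norm _)) vd.
rewrite -(ler_pXn2r n0) ?nnegrE ?(ltW e0)// (le_trans (uv t))//.
rewrite (le_trans (ler_wpM2l C0 vd))// mulrCA ler_piMr ?exprn_ge0 ?(ltW e0)//.
by rewrite ler_pdivrMr ?ltr_wpDl// mul1r lerDl.
Qed.

(** * Reduction of universality to bounded functions of mean zero *)

Definition universal_bounded (R : realType)
    (nu : probability (measurableTypeR R) R) : Prop :=
  forall (d : measure_display) (X : measurableType d) (mu : probability X R)
    (T : R -> X -> X) (M : R) (g : X -> R),
  standard_borel R X -> is_flow mu T -> ergodic mu T ->
  bounded_measurable M g -> \int[mu]_x g x = 0 ->
  (\int[mu]_x `|average nu (rescale T t) g x|) @[t --> +oo] --> 0.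

Section AverageError.
Context (R : realType) (d : measure_display) (X : measurableType d).
Variables (mu : probability X R) (T : R -> X -> X).
Hypothesis flowT : is_flow mu T.
Variable nu : probability (measurableTypeR R) R.

Lemma bounded_measurable_center M (g : X -> R) : bounded_measurable M g ->
  bounded_measurable (M + `|\int[mu]_x g x|) (fun x => g x - \int[mu]_y g y).
Proof.
move=> [mg gM]; split; first exact: measurable_funB.
by move=> x; rewrite (le_trans (ler_normB _ _))// lerD2r.
Qed.

Lemma Rintegral_center M (g : X -> R) : bounded_measurable M g ->
  \int[mu]_x (g x - \int[mu]_y g y) = 0.
Proof.
move=> bg; rewrite RintegralB//.
- by rewrite Rintegral_cst_probability subrr.
- exact: (bounded_measurable_integrable _ bg).
- exact: (bounded_measurable_integrable _ (bounded_measurable_cst _ _)).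
Qed.

Lemma average_error_center M (g : X -> R) t x : bounded_measurable M g ->
  average_error mu nu T g t x =
  (average nu (rescale T t) (fun x => g x - \int[mu]_y g y) x)%:E.
Proof.
move=> bg.
have bt := bounded_measurable_time (flow_rescale flowT t) x bg.
rewrite /average RintegralB//; last 2 first.
- exact: (bounded_measurable_integrable _ bt).
- exact: (bounded_measurable_integrable _ (bounded_measurable_cst _ _)).
rewrite Rintegral_cst_probability EFinB /average_error; congr (_ - _)%E.
  rewrite fineK//; apply: integrable_fin_num => //.
  exact: (bounded_measurable_integrable _ bt).
rewrite fineK//; apply: integrable_fin_num => //.
exact: (bounded_measurable_integrable _ bg).
Qed.

Lemma Lnorm1_average_error M (g : X -> R) t : bounded_measurable M g ->
  'N[mu]_1 [average_error mu nu T g t]%E =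
  (\int[mu]_x `|average nu (rescale T t) (fun x => g x - \int[mu]_y g y) x|)%:E.
Proof.
move=> bg; rewrite Lnorm1.
under eq_integral do rewrite (average_error_center _ _ bg) /=.
rewrite fineK//; apply: integrable_fin_num => //.
have bA := bounded_measurable_average (flow_rescale flowT t) nu
  (bounded_measurable_center bg).
exact: (bounded_measurable_integrable _ (bounded_measurable_norm bA)).
Qed.

(** The inner integral is the difference of the integrals of the positive and
    negative parts, each measurable in x by Tonelli. *)
Lemma measurable_average_error (f : X -> R) t : measurable_fun setT f ->
  measurable_fun setT (average_error mu nu T f t).
Proof.
move=> mf; apply: emeasurable_funB; last exact: measurable_cst.
have mfT : measurable_fun setT (fun p : measurableTypeR R * X =>
    (f (rescale T t p.1 p.2))%:E).
  apply: measurableT_comp => //.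
  exact: (measurableT_comp mf (flow_measurable (flow_rescale flowT t))).
have FE : (fun x => \int[nu]_r (f (T (r * t) x))%:E)%E =
    (fun x => \int[nu]_r ((fun p : measurableTypeR R * X =>
        (f (rescale T t p.1 p.2))%:E)^\+ (r, x)) -
      \int[nu]_r ((fun p : measurableTypeR R * X =>
        (f (rescale T t p.1 p.2))%:E)^\- (r, x)))%E.
  by apply/funext => x; rewrite integralE; congr (_ - _)%E;
    apply: eq_integral => r _; rewrite ?funeposE ?funenegE.
rewrite FE; apply: emeasurable_funB.
  apply: (measurable_fun_fubini_tonelli_G (m1 := nu) (_^\+)%E) => //.
  exact: measurable_funepos.
apply: (measurable_fun_fubini_tonelli_G (m1 := nu) (_^\-)%E) => //.
exact: measurable_funeneg.
Qed.

(** The bound holds at every point x, even where f is not integrable along the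
    orbit: since g is bounded, the right-hand side is then infinite. *)
Lemma average_error_le (f g : X -> R) M t x :
  mu.-integrable setT (EFin \o f) -> bounded_measurable M g ->
  (`|average_error mu nu T f t x| <= `|average_error mu nu T g t x| +
    (\int[nu]_r `|f (T (r * t) x) - g (T (r * t) x)|%:E +
     \int[mu]_y `|f y - g y|%:E))%E.
Proof.
move=> fi bg.
have gi := bounded_measurable_integrable mu bg.
have mf : measurable_fun setT f.
  exact/measurable_EFinP/(measurable_int mu fi).
have flowt := flow_rescale flowT t.
have mT : measurable_fun setT (fun r : measurableTypeR R => T (r * t) x).
  have mx : measurable_fun setT (fun r : measurableTypeR R => (r, x)).
    exact: measurable_fun_pair.
  exact: (measurableT_comp (flow_measurable flowt) mx).
have gti := bounded_measurable_integrable nu (bounded_measurable_time flowt x bg).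
have dfi : (\int[mu]_y (f y - g y)%:E = \int[mu]_y (f y)%:E - \int[mu]_y (g y)%:E)%E.
  exact: integralB_EFin.
have dle : (`|\int[mu]_y (f y - g y)%:E| <= \int[mu]_y `|f y - g y|%:E)%E.
  apply: le_abse_integral => //; apply: measurableT_comp => //.
  by apply: measurable_funB => //; case: bg.
have mD : measurable_fun setT (fun r : measurableTypeR R =>
    f (T (r * t) x) - g (T (r * t) x)).
  apply: measurable_funB; first exact: (measurableT_comp mf mT).
  by apply: (measurableT_comp _ mT); case: bg.
have [tfin|] := ltP (\int[nu]_r `|f (T (r * t) x) - g (T (r * t) x)|%:E)%E +oo%E;
  last first.
  rewrite leye_eq => /eqP ->; rewrite addye; last first.
    by rewrite gt_eqF// (lt_le_trans _ (integral_ge0 _ _))// => y _; rewrite lee_fin.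
  by rewrite addey ?leey// gt_eqF// (lt_le_trans (ltNyr 0))// abse_ge0.
have di : nu.-integrable setT (EFin \o (fun r => f (T (r * t) x) - g (T (r * t) x))).
  by apply/integrableP; split => //; exact: measurableT_comp.
have tle : (`|\int[nu]_r (f (T (r * t) x) - g (T (r * t) x))%:E| <=
    \int[nu]_r `|f (T (r * t) x) - g (T (r * t) x)|%:E)%E.
  by apply: le_abse_integral => //; exact: measurableT_comp.
have ftE : (\int[nu]_r (f (T (r * t) x))%:E = \int[nu]_r (g (T (r * t) x))%:E +
    \int[nu]_r (f (T (r * t) x) - g (T (r * t) x))%:E)%E.
  rewrite -integralD_EFin//; apply: eq_integral => r _.
  by congr EFin; rewrite addrC subrK.
have -> : average_error mu nu T f t x = (average_error mu nu T g t x +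
    (\int[nu]_r (f (T (r * t) x) - g (T (r * t) x))%:E -
     \int[mu]_y (f y - g y)%:E))%E.
  rewrite /average_error ftE dfi.
  have /fineK <- := integrable_fin_num measurableT fi.
  have /fineK <- := integrable_fin_num measurableT gi.
  have /fineK <- := integrable_fin_num measurableT gti.
  have /fineK <- := integrable_fin_num measurableT di.
  rewrite -!EFinB -!EFinD; congr EFin; ring.
rewrite (le_trans (lee_abs_add _ _))// leeD2l// (le_trans (lee_abs_sub _ _))//.
exact: leeD.
Qed.

(** Integrate the pointwise bound over x; by Tonelli and invariance of mu, the
    orbit term contributes the L1 distance from f to g once more. *)
Lemma Lnorm1_average_error_le (f g : X -> R) M t :
  mu.-integrable setT (EFin \o f) -> bounded_measurable M g ->
  ('N[mu]_1 [average_error mu nu T f t] <= 'N[mu]_1 [average_error mu nu T g t] +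
    (\int[mu]_y `|f y - g y|%:E + \int[mu]_y `|f y - g y|%:E))%E.
Proof.
move=> fi bg; rewrite !Lnorm1.
have mf : measurable_fun setT f.
  exact/measurable_EFinP/(measurable_int mu fi).
have mg : measurable_fun setT g by case: bg.
have flowt := flow_rescale flowT t.
have mD : measurable_fun setT (fun y => `|f y - g y|%:E).
  apply: measurableT_comp => //; apply: measurableT_comp => //.
  exact: measurable_funB.
have mDT : measurable_fun setT (fun p : measurableTypeR R * X =>
    `|f (rescale T t p.1 p.2) - g (rescale T t p.1 p.2)|%:E).
  exact: (measurableT_comp mD (flow_measurable flowt)).
have D0 (y : X) : (0 <= `|f y - g y|%:E)%E by rewrite lee_fin.
have tonelli : (\int[mu]_x \int[nu]_r `|f (T (r * t) x) - g (T (r * t) x)|%:E =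
    \int[mu]_y `|f y - g y|%:E)%E.
  rewrite -(fubini_tonelli (m1 := nu) (m2 := mu) _ mDT)//=.
  under eq_integral do rewrite (ge0_integral_flow flowt _ mD D0).
  by rewrite integral_cst// [X in (_ * X)%E]probability_setT mule1.
have mI : measurable_fun setT
    (fun x => \int[nu]_r `|f (T (r * t) x) - g (T (r * t) x)|%:E)%E.
  exact: (measurable_fun_fubini_tonelli_G _ mDT).
rewrite -[X in (_ + (X + _))%E]tonelli.
have cstE : (\int[mu]_y `|f y - g y|%:E =
    \int[mu]_(x in setT) \int[mu]_y `|f y - g y|%:E)%E.
  by rewrite integral_cst// [X in (_ * X)%E]probability_setT mule1.
rewrite [X in (_ + (_ + X))%E]cstE -ge0_integralD//.
- rewrite -ge0_integralD//.
  + apply: ge0_le_integral => //.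
    * apply: measurableT_comp => //; exact: measurable_average_error.
    * apply: emeasurable_funD; last exact: emeasurable_funD.
      by apply: measurableT_comp => //; exact: measurable_average_error.
    * by move=> x _; exact: average_error_le fi bg.
  + by apply: measurableT_comp => //; exact: measurable_average_error.
  + by move=> x _; rewrite adde_ge0// integral_ge0.
  + exact: emeasurable_funD.
- by move=> x _; exact: integral_ge0.
- by move=> x _; exact: integral_ge0.
Qed.

End AverageError.

Import HBSimple.

(** Approximating f in L1 by a simple function h within e / 4 costs at most
    e / 2 in the L1 norm of the error, uniformly in t. *)
Lemma universalP (R : realType) (nu : probability (measurableTypeR R) R) :
  universal nu <-> universal_bounded nu.
Proof.
split=> [un d X mu T M g sX flowT ergT bg g0|ub d X mu T f sX flowT ergT fi].
- have gi := bounded_measurable_integrable mu bg.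
  have gE : (fun x => g x - \int[mu]_y g y) = g.
    by apply/funext => x; rewrite g0 subr0.
  have := un d X mu T g sX flowT ergT gi.
  under eq_fun do rewrite (Lnorm1_average_error flowT nu _ bg) gE.
  by move/fine_cvgP => [_].
- apply: ge0_cvge0 => [t|e e0]; first by rewrite Lnorm1 integral_ge0.
  have [h [hi _ /fine_cvgP[hfin /cvgrPdist_le hcvg]]] :=
    approximation_sfun_integrable measurableT fi.
  have e4 : 0 < e / 4 by rewrite divr_gt0.
  have [n [/= nfin nle]] := filter_ex (filterI hfin (hcvg _ e4)).
  have [M0 [_ hM]] := simple_bounded (h n).
  have bh : bounded_measurable (M0 + 1) (h n).
    by split => // x; apply: hM => //; rewrite ltrDl.
  have bc := bounded_measurable_center mu bh.
  have e2 : 0 < e / 2 by rewrite divr_gt0.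
  have /cvgrPdist_le /(_ _ e2) :=
    ub d X mu T _ _ sX flowT ergT bc (Rintegral_center mu bh).
  apply: filterS => t /=; rewrite sub0r normrN => le2.
  rewrite (le_trans (Lnorm1_average_error_le flowT nu t fi bh))//.
  rewrite (Lnorm1_average_error flowT nu t bh) -(fineK nfin) -!EFinD lee_fin.
  move: nle le2; rewrite sub0r normrN => /(le_trans (ler_norm _)) nle.
  move=> /(le_trans (ler_norm _)); lra.
Qed.

(** * Descent along the convolution powers *)

(** Apply the L1 inequality to the average of g along rho, which inherits the
    bound M of g. *)
Lemma universal_bounded_convolution (R : realType)
    (nu rho : probability (measurableTypeR R) R) :
  universal_bounded (convolution nu (convolution nu rho)) ->
  universal_bounded (convolution nu rho).
Proof.
move=> un d X mu T M g sX flowT ergT bg g0.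
have M0 : 0 <= M by case: bg => _ /(_ point); apply: le_trans.
have M3 : 0 <= M ^+ 3 by rewrite exprn_ge0.
have un0 := un d X mu T M g sX flowT ergT bg g0.
refine (cvg0_expn_le (isT : 0 < 4)%N M3 _ _ un0).
- by move=> t; apply: Rintegral_ge0 => x _; exact: normr_ge0.
- move=> t; have flowt := flow_rescale flowT t.
  rewrite !(average_convolution flowt _ _ bg).
  have bh := bounded_measurable_average flowt rho bg.
  exact: (Rintegral_norm_average_le flowt nu bh).
Qed.

Lemma universal_bounded_convolution_dirac0 (R : realType)
    (nu : probability (measurableTypeR R) R) :
  universal_bounded (convolution nu (@dirac _ (measurableTypeR R) 0 R)) ->
  universal_bounded nu.
Proof.
move=> un d X mu T M g sX flowT ergT bg g0.
have := un d X mu T M g sX flowT ergT bg g0.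
under eq_fun => t do rewrite (average_convolution (flow_rescale flowT t) _ _ bg)
  (average_dirac0 (flow_rescale flowT t) bg).
by [].
Qed.

Theorem theorem1p2 (R : realType) (nu : probability (measurableTypeR R) R) :
  (exists2 n : nat, (1 <= n)%N & universal (convolution_power nu n)) ->
  universal nu.
Proof.
case=> -[//|n _] /universalP un; apply/universalP.
elim: n un => [|n IHn] un; first exact: universal_bounded_convolution_dirac0.
by apply: IHn; exact: universal_bounded_convolution un.
Qed.
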